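(* Let $X$ be a real Hilbert space, let $m\in\{1,2,\ldots\}$, and let $R_1,\ldots,R_m\colon X\to X$ be nonexpansive. Suppose there exists $j\in\{1,\ldots,m\}$ such that $R_i$ is averaged nonexpansive for every $i\in\{1,\ldots,m\}$ with $i\neq j$. Let $\sigma$ be a permutation of $\{1,\ldots,m\}$. Then $$\overline{\operatorname{ran}}(\operatorname{Id}-R_m\cdots R_1)=\overline{\operatorname{ran}(\operatorname{Id}-R_1)+\cdots+\operatorname{ran}(\operatorname{Id}-R_m)}=\overline{\operatorname{ran}}\big(\operatorname{Id}-R_{\sigma(m)}\cdots R_{\sigma(1)}\big);$$ consequently, $$\operatorname{v}_{R_{\sigma(m)}\cdots R_{\sigma(1)}}=\operatorname{v}_{R_m\cdots R_1}=P_{\overline{\operatorname{ran}(\operatorname{Id}-R_1)+\cdots+\operatorname{ran}(\operatorname{Id}-R_m)}}(0)$$ and $$\|\operatorname{v}_{R_{\sigma(m)}\cdots R_{\sigma(1)}}\|=\|\operatorname{v}_{R_m\cdots R_1}\|\leq\|\operatorname{v}_{R_1}\|+\cdots+\|\operatorname{v}_{R_m}\|.$$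
   Context: $X$ is a real Hilbert space with induced norm $\|\cdot\|$; $\operatorname{Id}$ is the identity on $X$; products of operators denote composition; sums of sets are Minkowski sums; $\overline{\operatorname{ran}}(T)$ is the norm closure of the range $\operatorname{ran}(T)$ of $T$. A map $R\colon X\to X$ is nonexpansive if $\|Rx-Ry\|\leq\|x-y\|$ for all $x,y\in X$. $R$ is averaged (averaged nonexpansive) if there are $\alpha\in[0,1)$ and a nonexpansive $N\colon X\to X$ with $R=(1-\alpha)\operatorname{Id}+\alpha N$. For a nonempty closed convex set $C\subseteq X$, $P_C$ is the metric projection onto $C$. For $R$ nonexpansive, $\overline{\operatorname{ran}}(\operatorname{Id}-R)$ is nonempty, closed and convex, and the minimal displacement vector of $R$ is $\operatorname{v}_R=P_{\overline{\operatorname{ran}}(\operatorname{Id}-R)}(0)$. *)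

(* Defs.v *)
From mathcomp Require Import all_boot all_order all_fingroup all_algebra.
From mathcomp Require Import all_classical all_reals all_analysis.

Set Implicit Arguments.
Unset Strict Implicit.
Unset Printing Implicit Defensive.

Import Order.TTheory GRing.Theory Num.Theory.
Import numFieldNormedType.Exports.

Local Open Scope classical_set_scope.
Local Open Scope ring_scope.

Section displacement.
Context {R : realType} {X : normedModType R}.
Implicit Types (T N : X -> X) (C : set X).

Definition nonexpansive T := forall x y, `|T x - T y| <= `|x - y|.

Definition averaged T := exists (a : R) N,
  [/\ 0 <= a < 1, nonexpansive N & forall x, T x = (1 - a) *: x + a *: N x].

Definition ran_id_sub T : set X := range (fun x => x - T x).

(* T_(m-1) \o ... \o T_0: the operator of index 0 acts first. *)
Definition compose m (T : 'I_m -> X -> X) : X -> X :=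
  \big[catcomp/id]_(i < m) T i.

Definition minkowski_sum m (A : 'I_m -> set X) : set X :=
  [set \sum_(i < m) x i | x in [set x : 'I_m -> X | forall i, A i (x i)]].

Definition is_nearest C (x p : X) :=
  C p /\ forall c, C c -> `|x - p| <= `|x - c|.

(* In a Hilbert space the nearest point exists and is unique when C is nonempty,
   closed and convex; if there is no nearest point, the value is 0. *)
Definition metric_proj C (x : X) : X := xget 0 [set p | is_nearest C x p].

Definition min_displacement T : X := metric_proj (closure (ran_id_sub T)) 0.

End displacement.

(* Main.v *)
(* Write G(T, w, z), below bounded_excess, when |T y + w - z|^2 - |y - z|^2 is
   bounded above over y.  If w = b - T b with T nonexpansive, then G(T, w, b)
   holds, and if T is averaged, then G(T, w, z) holds for every z.  Since
   G(T, w, z) and G(T', w', z - w) give G(T' o T, w + w', z), a composition of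
   nonexpansive maps, all averaged but one, satisfies G for every sum of
   displacements and a suitable z.  Conversely, for T nonexpansive, G(T, w, z)
   forces w into the closure of ran (Id - T): the fixed point x of the
   contraction x |-> z + (1 - e) (T x + w - z) satisfies
   |w - (x - T x)|^2 <= e C.  By the parallelogram law, G also holds for the
   midpoint of two displacements of a single nonexpansive map; hence the closure
   of ran (Id - T) is stable under midpoints and has a point of least norm. *)
Require Import Defs.
From mathcomp Require Import all_boot all_order all_fingroup all_algebra.
From mathcomp Require Import all_classical all_reals all_analysis.
From mathcomp Require Import ring lra.

Set Implicit Arguments.
Unset Strict Implicit.
Unset Printing Implicit Defensive.

Import Order.TTheory GRing.Theory Num.Theory.
Import numFieldNormedType.Exports.

Local Open Scope classical_set_scope.
Local Open Scope ring_scope.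

(** * Closures and metric projections in normed spaces *)

Section normed.
Context {R : realType} {X : normedModType R}.
Implicit Types (A C : set X).

Lemma half_add (x : X) : 2^-1 *: (x + x) = x.
Proof.
rewrite scalerDr -scalerDl.
have -> : 2^-1 + 2^-1 = 1 :> R by lra.
exact: scale1r.
Qed.

Lemma closure_normP A (x : X) :
  closure A x <-> forall e : R, 0 < e -> exists2 a, A a & `|x - a| < e.
Proof.
split=> [clx e e0 | h B /nbhs_ballP[e /= e0 eB]].
- have [a [Aa]] := clx _ (nbhsx_ballx x e e0).
  by rewrite -ball_normE => xa; exists a.
- have [a Aa xa] := h e e0; exists a; split=> //.
  by apply: eB; rewrite -ball_normE.
Qed.

Lemma closure_le A C : A `<=` closure C -> closure A `<=` closure C.
Proof.
by move=> AC x /(closure_subset AC); exact: closed_closure.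
Qed.

Lemma metric_projP C (x : X) :
  (exists p, is_nearest C x p) -> is_nearest C x (metric_proj C x).
Proof. exact: (@xgetPex _ 0 [set p | is_nearest C x p]). Qed.

End normed.

(** * Displacements and excess bounds of compositions *)

Section composition.
Context {R : realType} {X : normedModType R}.

Lemma composeS m (T : 'I_m.+1 -> X -> X) x :
  compose T x = compose (fun i => T (lift ord0 i)) (T ord0 x).
Proof. by rewrite /compose big_ord_recl. Qed.

Lemma compose0 (T : 'I_0 -> X -> X) x : compose T x = x.
Proof. by rewrite /compose big_ord0. Qed.

Lemma compose_nonexpansive m (T : 'I_m -> X -> X) :
  (forall i, nonexpansive (T i)) -> nonexpansive (compose T).
Proof.
elim: m T => [|m IH] T neT x y; first by rewrite !compose0.
rewrite !composeS; apply: le_trans (neT ord0 x y).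
by apply: IH => i; exact: neT.
Qed.

(** The displacement telescopes along the orbit [x], [T_0 x], [T_1 (T_0 x)], ...: each step of the
    orbit is a displacement of one factor. *)
Lemma ran_compose_sub m (T : 'I_m -> X -> X) :
  ran_id_sub (compose T) `<=` minkowski_sum (fun i => ran_id_sub (T i)).
Proof.
move=> _ [x _ <-].
suff [w wT ->] : exists2 w : 'I_m -> X, (forall i, ran_id_sub (T i) (w i))
    & x - compose T x = \sum_(i < m) w i by exists w.
elim: m T x => [|m IH] T x.
  by exists (fun=> 0) => [[]//|]; rewrite compose0 big_ord0 subrr.
have [w wT ew] := IH (fun i => T (lift ord0 i)) (T ord0 x).
exists (fun i => if unlift ord0 i is Some k then w k else x - T ord0 x).
  by move=> i; case: unliftP => [k|] ->; [exact: wT | exists x].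
rewrite big_ord_recl unlift_none.
under eq_bigr do rewrite liftK.
by rewrite -ew composeS addrA subrK.
Qed.

Lemma minkowski_sum_perm m (A : 'I_m -> set X) (s : 'S_m) :
  minkowski_sum (fun i => A (s i)) = minkowski_sum A.
Proof.
apply/seteqP; split=> _ /= [x xA <-].
- exists (fun i => x (s^-1 i)%g).
    by move=> i /=; have := xA (s^-1 i)%g; rewrite permKV.
  by rewrite [LHS](reindex_perm s)/=; apply: eq_bigr => i _; rewrite permK.
- exists (fun i => x (s i)); first by move=> i /=; exact: xA.
  by rewrite [RHS](reindex_perm s).
Qed.

Definition bounded_excess (T : X -> X) (w z : X) :=
  exists C : R, forall y, `|T y + w - z| ^+ 2 <= `|y - z| ^+ 2 + C.

Lemma nonexpansive_bounded_excess T b :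
  nonexpansive T -> bounded_excess T (b - T b) b.
Proof.
move=> neT; exists 0 => y.
by rewrite addr0 addrCA addrAC subrr add0r ler_pXn2r ?nnegrE.
Qed.

(** The bound for [T'] at the point [T y] compares with [T y - (z - w)], which is the vector
    [T y + w - z] controlled by the bound for [T]; the constants add up. *)
Lemma bounded_excess_comp T T' w w' z :
  bounded_excess T w z -> bounded_excess T' w' (z - w) ->
  bounded_excess (T' \o T) (w + w') z.
Proof.
move=> [C hC] [C' hC']; exists (C + C') => y /=.
have := hC' (T y).
rewrite [w + w']addrC !opprB !addrA [_ + w]addrAC => h.
have := hC y; rewrite -[_ + w - z]addrA [w - z]addrC addrA in h *; lra.
Qed.

Lemma compose_bounded_excess_all m (T : 'I_m -> X -> X) (w : 'I_m -> X) :
  (forall i z, bounded_excess (T i) (w i) z) ->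
  forall z, bounded_excess (compose T) (\sum_(i < m) w i) z.
Proof.
elim: m T w => [|m IH] T w h z.
  by exists 0 => y; rewrite compose0 big_ord0 !addr0.
have [C hC] := bounded_excess_comp (h ord0 z)
  (IH (fun i => T (lift ord0 i)) _ (fun i => h (lift ord0 i)) (z - w ord0)).
by exists C => y; rewrite composeS big_ord_recl; exact: hC.
Qed.

(** Only the factor [j] dictates a base point. Each factor acting before [j] shifts the base by its
    own [w i], so the suitable [z] is [z0] plus those shifts. *)
Lemma compose_bounded_excess m (T : 'I_m -> X -> X) (w : 'I_m -> X) j z0 :
  (forall i z, i != j -> bounded_excess (T i) (w i) z) ->
  bounded_excess (T j) (w j) z0 ->
  exists z, bounded_excess (compose T) (\sum_(i < m) w i) z.
Proof.
elim: m T w j => [|m IH] T w j; first by case: j => -[].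
move=> hall hj.
suff [z [hz0 hz]] : exists z, bounded_excess (T ord0) (w ord0) z /\
    bounded_excess (compose (fun i => T (lift ord0 i)))
      (\sum_(i < m) w (lift ord0 i)) (z - w ord0).
  have [C hC] := bounded_excess_comp hz0 hz.
  by exists z, C => y; rewrite composeS big_ord_recl; exact: hC.
case: (unliftP ord0 j) hall hj => [k|] -> hall hj.
- have [i z ik|z hz] :=
    IH (fun i => T (lift ord0 i)) (fun i => w (lift ord0 i)) k _ hj.
    by apply: hall; rewrite (inj_eq lift_inj).
  by exists (z + w ord0); rewrite addrK; split=> //; exact: hall.
- exists z0; split=> //; apply: compose_bounded_excess_all => i z.
  by apply: hall; rewrite eq_sym neq_lift.
Qed.

End composition.

(** * Consequences of completeness: approximate displacements and nearest points *)

Section complete.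
Context {R : realType} {X : completeNormedModType R}.

Lemma strict_lipschitz_fixed_point (k : R) (f : X -> X) : 0 <= k < 1 ->
  (forall x y, `|f x - f y| <= k * `|x - y|) -> exists x, f x = x.
Proof.
move=> /andP[k0 k1] fk.
have [|||p _ pE] := @banach_fixed_point R X setT [fun of totalfun f].
- by exists (NngNum k0); split=> // -[x y] _; exact: fk.
- exact: closedT.
- by exists 0.
- by exists p.
Qed.

Lemma bounded_excess_closure (T : X -> X) w z : nonexpansive T ->
  bounded_excess T w z -> closure (ran_id_sub T) w.
Proof.
move=> neT [C hC]; apply/closure_normP => d d0.
(* [M] exceeds both [C], whose sign is unknown, and [d ^+ 2]; hence [e = d ^+ 2 / M] lies in (0, 1)
   and [e * C < d ^+ 2]. *)
pose M : R := `|C| + d ^+ 2 + 1.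
have M0 : 0 < M by rewrite /M ltr_wpDl// addr_ge0// sqr_ge0.
pose e : R := d ^+ 2 / M.
have dM : d ^+ 2 < M by rewrite /M; have := normr_ge0 C; lra.
have e0 : 0 < e by rewrite divr_gt0// exprn_gt0.
have e1 : e < 1 by rewrite ltr_pdivrMr// mul1r.
have [x xE] : exists x, z + (1 - e) *: (T x + w - z) = x.
  apply: (@strict_lipschitz_fixed_point (1 - e)); first lra.
  move=> x y; rewrite [z + _]addrC addrKA -scalerBr normrZ ger0_norm; last lra.
  rewrite -[T x + w - z]addrA -[T y + w - z]addrA [T y + _]addrC addrKA.
  by apply: ler_wpM2l (neT x y); lra.
exists (x - T x); first by exists x.
set u := T x + w - z in xE.
have xz : x - z = (1 - e) *: u by rewrite -xE addrC addKr.
have -> : w - (x - T x) = e *: u.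
  have -> : e *: u = u - (x - z) by rewrite xz -{2}[u]scale1r -scalerBl subKr.
  by rewrite /u !opprB subrKA addrA [w + _]addrC.
have := hC x; rewrite -/u xz normrZ ger0_norm; last lra.
move=> hu.
have eM : e * M = d ^+ 2 by rewrite mulrVK// unitfE gt_eqF.
have CM : C < M by rewrite /M; have := ler_norm C; have := sqr_ge0 d; lra.
have U0 := sqr_ge0 `|u|.
have eu0 : 0 <= e * `|u| by rewrite mulr_ge0// ltW.
rewrite normrZ gtr0_norm// -(ltr_pXn2r (n:=2)) ?nnegrE// ?ltW// exprMn.
rewrite exprMn in hu.
(* [hu] reads |u|^2 <= (1 - e)^2 |u|^2 + C, and (1 - e)^2 <= 1 - e. *)
have eU : e * `|u| ^+ 2 <= C by nra.
have : e * (e * `|u| ^+ 2) <= e * C by rewrite ler_wpM2l// ltW.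
have : e * C < e * M by rewrite ltr_pM2l.
by rewrite eM expr2 mulrA; lra.
Qed.

(** The classical projection argument: a minimizing sequence is Cauchy by the parallelogram law,
    because midpoints of its terms stay in [C] and cannot beat the infimum. *)
Lemma nearest_midpoint_closed (C : set X) (x : X) :
  (forall u v : X,
    `|u + v| ^+ 2 + `|u - v| ^+ 2 = 2 * (`|u| ^+ 2 + `|v| ^+ 2)) ->
  closed C -> C !=set0 -> (forall u v, C u -> C v -> C (2^-1 *: (u + v))) ->
  exists p, is_nearest C x p.
Proof.
move=> parallelogram clC [c0 Cc0] midC.
pose E := [set `|x - c| ^+ 2 | c in C]; pose D := inf E.
have infE : has_inf E.
  split; first by exists (`|x - c0| ^+ 2), c0.
  by exists 0 => _ [c _ <-]; exact: sqr_ge0.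
have D_le c : C c -> D <= `|x - c| ^+ 2.
  by move=> Cc; apply: ge_inf; [case: infE | exists c].
have /choice[c hc] n : exists c, C c /\ `|x - c| ^+ 2 < D + n.+1%:R^-1.
  have n0 : 0 < n.+1%:R^-1 :> R by rewrite invr_gt0 ltr0n.
  by have [_ [c Cc <-] lt] := inf_adherent n0 infE; exists c.
(* The midpoint bound gives |(x - c i) + (x - c j)|^2 >= 4 D, which cancels the 4 D on the right of
   the parallelogram law. *)
have dist_le i j :
    `|c i - c j| ^+ 2 <= 2 * (i.+1%:R^-1 + j.+1%:R^-1).
  have := parallelogram (x - c i) (x - c j).
  have := D_le _ (midC _ _ (hc i).1 (hc j).1).
  have -> : x - 2^-1 *: (c i + c j) = 2^-1 *: (x - c i + (x - c j)).
    by rewrite addrACA -opprD scalerBr half_add.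
  rewrite opprB [_ + (c j - x)]addrC subrKA [`|c j - _|]distrC.
  rewrite normrZ exprMn ger0_norm ?invr_ge0//.
  by move: (hc i).2 (hc j).2; move: i.+1%:R^-1 j.+1%:R^-1 => s t; lra.
have cvgc : cvgn c.
  apply/cauchy_cvgP/cauchy_ballP => e e0.
  (* Two reciprocals below this threshold make the bound in [dist_le] smaller than [e ^+ 2]. *)
  have e4 : 0 < e ^+ 2 / 4 by rewrite divr_gt0// exprn_gt0.
  near_simpl; near=> i j.
  rewrite -ball_normE /= -(ltr_pXn2r (n:=2)) ?nnegrE ?(ltW e0)//.
  apply: le_lt_trans (dist_le _ _) _.
  have : i.+1%:R^-1 < e ^+ 2 / 4.
    by near: i; exact: (near_infty_natSinv_lt (PosNum e4)).
  have : j.+1%:R^-1 < e ^+ 2 / 4.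
    by near: j; exact: (near_infty_natSinv_lt (PosNum e4)).
  move: i.+1%:R^-1 j.+1%:R^-1 => s t; lra.
exists (limn c); split.
  by apply: (closed_cvg C) cvgc => //; apply: nearW => n; exact: (hc n).1.
move=> a Ca; rewrite -(ler_pXn2r (n:=2)) ?nnegrE//.
apply: le_trans (D_le _ Ca).
have cD : D + (n.+1%:R^-1 : R) @[n --> \oo] --> D + 0.
  exact: cvgD (cvg_cst _) cvg_harmonic.
have cN : `|x - c n| ^+ 2 @[n --> \oo] --> `|x - limn c| ^+ 2.
  by under eq_fun do rewrite expr2; rewrite expr2; apply: cvgM;
     apply: cvg_norm; apply: cvgB cvgc; exact: cvg_cst.
rewrite -[D]addr0; apply: ler_cvg_to cN cD _.
by apply: nearW => n; exact: ltW (hc n).2.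
Unshelve. all: by end_near. Qed.

End complete.

(** * Inner product estimates for averaged maps and for midpoints *)

Section hilbert.
Context {R : realType} {X : normedModType R}.
Context (ip : {dot X for idfun}) (norm_ip : forall x : X, ip x x = `|x| ^+ 2).

Lemma ipC (x y : X) : ip x y = ip y x.
Proof. by rewrite hermC expr0 mul1r. Qed.

Lemma ipDr (x y z : X) : ip x (y + z) = ip x y + ip x z.
Proof. exact: linearDr. Qed.

Lemma ipNr (x y : X) : ip x (- y) = - ip x y.
Proof. exact: linearNr. Qed.

Lemma ipZl (a : R) (x y : X) : ip (a *: x) y = a * ip x y.
Proof. exact: linearZl_LR. Qed.

Lemma sqr_normD (x y : X) : `|x + y| ^+ 2 = `|x| ^+ 2 + 2 * ip x y + `|y| ^+ 2.
Proof.
rewrite -!norm_ip ipDr ![ip (x + y) _]ipC !ipDr [ip y x]ipC; ring.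
Qed.

Lemma sqr_normZ (a : R) (x : X) : `|a *: x| ^+ 2 = a ^+ 2 * `|x| ^+ 2.
Proof. by rewrite normrZ exprMn real_normK ?num_real. Qed.

Lemma parallelogram (x y : X) :
  `|x + y| ^+ 2 + `|x - y| ^+ 2 = 2 * (`|x| ^+ 2 + `|y| ^+ 2).
Proof. rewrite !sqr_normD normrN ipNr; ring. Qed.

(** With [u], [v], [c] as set below, the vector to bound is v + c + a u. Nonexpansiveness of [N]
    gives 2 <u, v> <= - |u|^2, so expanding the square leaves a gain of a (1 - a) |u|^2. This
    absorbs the cross term 2 a <u, c> at the cost of a / (1 - a) |c|^2, which is the constant. *)
Lemma averaged_bounded_excess (T : X -> X) b z :
  averaged T -> bounded_excess T (b - T b) z.
Proof.
move=> [a [N [/andP[a0 a1] neN TE]]].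
exists (a / (1 - a) * `|b - z| ^+ 2) => y.
set v := y - b; set c := b - z; set u := N y - N b - v.
have vc : v + c = y - z by rewrite /v /c subrKA.
have {}TE x : T x = x + a *: (N x - x).
  by rewrite TE scalerBl scale1r scalerBr [a *: N x - _]addrC addrA.
have -> : T y + (b - T b) - z = v + c + a *: u.
  have -> : u = (N y - y) - (N b - b).
    by rewrite /u /v opprD [LHS]addrACA -opprD.
  rewrite vc !TE opprD addNKr [a *: (_ - _ - _)]scalerBr !addrA.
  by rewrite [LHS]addrAC [y + _ - z]addrAC.
rewrite -vc.
have uv : 2 * ip u v <= - `|u| ^+ 2.
  have : `|u + v| ^+ 2 <= `|v| ^+ 2.
    by rewrite subrK ler_pXn2r ?nnegrE//; exact: neN.
  by rewrite sqr_normD; lra.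
(* Young's inequality, weighted so that after multiplication by a / (1 - a) its |u|^2 term equals
   the available gain. *)
have uc : 2 * (1 - a) * ip u c <= (1 - a) ^+ 2 * `|u| ^+ 2 + `|c| ^+ 2.
  have := sqr_ge0 `|(1 - a) *: u - c|.
  rewrite sqr_normD sqr_normZ normrN ipNr ipZl; lra.
rewrite sqr_normD sqr_normZ [ip (v + c) _]ipC ipZl ipDr.
have : a / (1 - a) * (2 * (1 - a) * ip u c) <=
       a / (1 - a) * ((1 - a) ^+ 2 * `|u| ^+ 2 + `|c| ^+ 2).
  by rewrite ler_wpM2l// divr_ge0// subr_ge0 ltW.
have -> : a / (1 - a) * (2 * (1 - a) * ip u c) = 2 * a * ip u c by field; lra.
have -> : a / (1 - a) * ((1 - a) ^+ 2 * `|u| ^+ 2 + `|c| ^+ 2) =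
  a * (1 - a) * `|u| ^+ 2 + a / (1 - a) * `|c| ^+ 2 by field; lra.
have := ler_wpM2l a0 uv.
lra.
Qed.

(** Both sides are squared norms of averages: of [T y - T a] and [T y - T b], and of [y - a] and
    [y - b]. By the parallelogram law each is the mean of the squares minus a quarter of the squared
    difference; the constant is that correction on the [y] side. *)
Lemma midpoint_bounded_excess (T : X -> X) a b : nonexpansive T ->
  bounded_excess T (2^-1 *: ((a - T a) + (b - T b))) (2^-1 *: (a + b)).
Proof.
move=> neT; exists (`|2^-1 *: (a - b)| ^+ 2) => y.
have -> : T y + 2^-1 *: ((a - T a) + (b - T b)) - 2^-1 *: (a + b) =
    2^-1 *: ((T y - T a) + (T y - T b)).
  have -> : (a - T a) + (b - T b) = (- T a - T b) + (a + b).
    by rewrite [a - _]addrC [b - _]addrC addrACA.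
  by rewrite scalerDr addrA addrK -{1}[T y]half_add -scalerDr addrACA.
have -> : y - 2^-1 *: (a + b) = 2^-1 *: ((y - a) + (y - b)).
  by rewrite -{1}[y]half_add -scalerBr opprD addrACA.
have := parallelogram (y - a) (y - b).
rewrite [_ - (y - b)]addrC opprB subrKA -[b - a]opprB normrN => eyy.
have := parallelogram (T y - T a) (T y - T b).
have := sqr_ge0 `|T y - T a - (T y - T b)|.
have le c : `|T y - T c| ^+ 2 <= `|y - c| ^+ 2 by rewrite ler_pXn2r ?nnegrE.
have := le a; have := le b.
rewrite !sqr_normZ; lra.
Qed.

End hilbert.

(** * Minimal displacement vectors and the range of a composition *)

Section displacement.
Context {R : realType} {X : completeNormedModType R}.
Context (ip : {dot X for idfun}) (norm_ip : forall x : X, ip x x = `|x| ^+ 2).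

Lemma midpoint_closure_ran (T : X -> X) : nonexpansive T ->
  forall u v, closure (ran_id_sub T) u -> closure (ran_id_sub T) v ->
  closure (ran_id_sub T) (2^-1 *: (u + v)).
Proof.
move=> neT u v /closure_normP hu /closure_normP hv.
(* A midpoint of two displacements is only known to lie in the closure of the range, so the
   approximation takes place in the closure of the closure. *)
apply: closed_closure; apply/closure_normP => e e0.
have [_ [a _ <-] ua] := hu e e0; have [_ [b _ <-] vb] := hv e e0.
exists (2^-1 *: ((a - T a) + (b - T b))).
  exact: bounded_excess_closure neT (midpoint_bounded_excess norm_ip a b neT).
rewrite -scalerBr opprD addrACA normrZ ger0_norm ?invr_ge0//.
have := ler_normD (u - (a - T a)) (v - (b - T b)); lra.
Qed.

(** This rules out the default value of [metric_proj]: the minimal displacement is a genuine nearest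
    point. *)
Lemma min_displacementP (T : X -> X) : nonexpansive T ->
  is_nearest (closure (ran_id_sub T)) 0 (min_displacement T).
Proof.
move=> neT; apply: metric_projP; apply: nearest_midpoint_closed.
- exact: parallelogram norm_ip.
- exact: closed_closure.
- by exists (0 - T 0); apply: subset_closure; exists 0.
- exact: midpoint_closure_ran.
Qed.

Lemma closure_ran_compose m (T : 'I_m -> X -> X) :
  (forall i, nonexpansive (T i)) ->
  (exists j : 'I_m, forall i, i != j -> averaged (T i)) ->
  closure (ran_id_sub (compose T)) =
  closure (minkowski_sum (fun i => ran_id_sub (T i))).
Proof.
move=> neT [j avT]; apply/seteqP; split.
  exact/closure_subset/ran_compose_sub.
apply: closure_le => _ [w wT <-].
have /choice[b bE] i : exists b, b - T i b = w i.
  by have [b _ <-] := wT i; exists b.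
(* The exceptional factor admits the base point [b j], where its displacement [w j] is attained. *)
have [i z ij||z hz] := @compose_bounded_excess _ _ _ T w j (b j).
- by rewrite -bE; exact: (averaged_bounded_excess norm_ip _ _ (avT i ij)).
- by rewrite -bE; exact: nonexpansive_bounded_excess.
- exact: bounded_excess_closure (compose_nonexpansive neT) hz.
Qed.

Lemma nearest_minkowski_sum_le m (T : 'I_m -> X -> X) p :
  (forall i, nonexpansive (T i)) ->
  is_nearest (closure (minkowski_sum (fun i => ran_id_sub (T i)))) 0 p ->
  `|p| <= \sum_(i < m) `|min_displacement (T i)|.
Proof.
move=> neT [_ pmin]; apply/ler_addgt0Pr => e e0.
(* The [m] errors [d] sum to at most [e]; dividing by m + 1 also covers m = 0. *)
pose d := e / m.+1%:R.
have d0 : 0 < d by rewrite divr_gt0.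
have /choice[w wE] i : exists w, ran_id_sub (T i) w /\
    `|min_displacement (T i) - w| < d.
  have [/closure_normP/(_ _ d0)[w Tw ltw] _] := min_displacementP (neT i).
  by exists w.
have /pmin : closure (minkowski_sum (fun i => ran_id_sub (T i)))
    (\sum_(i < m) w i).
  by apply: subset_closure; exists w => // i; exact: (wE i).1.
rewrite !sub0r !normrN => /le_trans; apply.
apply: le_trans (ler_norm_sum _ _ _) _.
have : \sum_(i < m) `|w i| <= \sum_(i < m) (`|min_displacement (T i)| + d).
  apply: ler_sum => i _; have := (wE i).2.
  by have := lerB_dist (w i) (min_displacement (T i)); rewrite distrC; lra.
rewrite big_split /= sumr_const card_ord -mulr_natl => /le_trans; apply.
rewrite lerD2l /d mulrCA ler_piMr ?(ltW e0)//.
by rewrite ler_pdivrMr ?ltr0n// mul1r ler_nat.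
Qed.

End displacement.

(** * Permuted compositions *)

Theorem theorem4p1 (R : realType) (X : completeNormedModType R)
    (ip : {dot X for idfun}) (norm_ip : forall x : X, ip x x = `|x| ^+ 2)
    (m : nat) (m_gt0 : (0 < m)%N) (T : 'I_m -> X -> X)
    (T_ne : forall i, nonexpansive (T i))
    (T_av : exists j : 'I_m, forall i, i != j -> averaged (T i))
    (s : 'S_m) :
  let Ts := fun i => T (s i) in
  let S := closure (minkowski_sum (fun i => ran_id_sub (T i))) in
  (closure (ran_id_sub (compose T)) = S /\
   S = closure (ran_id_sub (compose Ts))) /\
  (min_displacement (compose Ts) = min_displacement (compose T) /\
   min_displacement (compose T) = metric_proj S 0) /\
  (`|min_displacement (compose Ts)| = `|min_displacement (compose T)| /\
   `|min_displacement (compose T)| <= \sum_(i < m) `|min_displacement (T i)|).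
Proof.
move=> Ts S.
have ranT : closure (ran_id_sub (compose T)) = S.
  exact: (closure_ran_compose norm_ip).
have ranTs : closure (ran_id_sub (compose Ts)) = S.
  rewrite /S -(minkowski_sum_perm _ s).
  apply: (closure_ran_compose norm_ip) => [i|]; first exact: T_ne.
  (* After reordering, the exceptional map sits at the index that [s] sends to [j]. *)
  have [j avT] := T_av; exists (s^-1 j)%g => i ij; apply: avT.
  by apply: contraNneq ij => <-; rewrite permK.
have eq_disp : min_displacement (compose Ts) = min_displacement (compose T).
  by rewrite /min_displacement ranT ranTs.
rewrite eq_disp ranT ranTs; do !split=> //.
  by rewrite /min_displacement ranT.
apply: (nearest_minkowski_sum_le norm_ip) => //; rewrite -/S -ranT.
exact: (min_displacementP norm_ip (compose_nonexpansive T_ne)).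
Qed.
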